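(* Let $\mathfrak{aff}(\mathbb{R})=\mathrm{span}\{e_1,e_2\}$ denote the $2$-dimensional real Lie algebra with Lie bracket $[e_1,e_2]=e_2$ and let $\omega=e^1\wedge e^2$ be the canonical symplectic form on $\mathfrak{aff}(\mathbb{R})$, where $\{e^1,e^2\}$ is the dual basis. Then the only flat torsion-free connections $\nabla$ on $\mathfrak{aff}(\mathbb{R})$ such that $\nabla\omega=0$ are the following: (a) for $\alpha\in\mathbb{R}$, $$\nabla_{e_1}e_1=-e_1+\alpha e_2,\quad \nabla_{e_1}e_2=e_2,\quad \nabla_{e_2}e_1=\nabla_{e_2}e_2=0;$$ (b) for $\alpha\in\mathbb{R}$, $$\nabla_{e_1}e_1=-\tfrac12 e_1+\alpha e_2,\quad \nabla_{e_1}e_2=\tfrac12 e_2,\quad \nabla_{e_2}e_1=-\tfrac12 e_2,\quad \nabla_{e_2}e_2=0.$$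
   Context: A connection on a real Lie algebra $\mathfrak h$ is a bilinear map $\nabla:\mathfrak h\times\mathfrak h\to\mathfrak h$, $(x,y)\mapsto\nabla_xy$; it is torsion-free if $\nabla_xy-\nabla_yx=[x,y]$ and flat if $\nabla_x\nabla_y-\nabla_y\nabla_x=\nabla_{[x,y]}$ for all $x,y$. For a 2-form $\omega$ on $\mathfrak h$, $\nabla\omega=0$ means $\omega(\nabla_xy,z)=\omega(\nabla_xz,y)$ for all $x,y,z\in\mathfrak h$. *)

(* Defs.v *)
From HB Require Import structures.
From mathcomp Require Import all_boot all_order all_algebra.
From mathcomp Require Import reals ring.

Set Implicit Arguments.
Unset Strict Implicit.
Unset Printing Implicit Defensive.

Import GRing.Theory.
Local Open Scope ring_scope.

HB.mixin Record Lmodule_isLie (R : comNzRingType) V of GRing.Lmodule R V := {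
  lie : {bilinear V -> V -> V};
  liexx : forall x, lie x x = 0;
  lie_jacobi : forall x y z,
    lie x (lie y z) + lie y (lie z x) + lie z (lie x y) = 0
}.

#[short(type="lieAlgType")]
HB.structure Definition LieAlgebra (R : comNzRingType) :=
  {V of GRing.Lmodule R V & Lmodule_isLie R V}.

Section Connections.
Variables (R : comNzRingType) (h : lieAlgType R).

(* A connection D : {bilinear h -> h -> h} is read with D x y = nabla_x y. *)
Definition torsion_free (D : {bilinear h -> h -> h}) :=
  forall x y : h, D x y - D y x = lie x y.

Definition flat (D : {bilinear h -> h -> h}) :=
  forall x y z : h, D x (D y z) - D y (D x z) = D (lie x y) z.

(* For a 2-form w, i.e. when w is alternating, this is nabla w = 0. *)
Definition parallel (w : {biscalar h}) (D : {bilinear h -> h -> h}) :=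
  forall x y z : h, w (D x y) z = w (D x z) y.

End Connections.

Section Wedge.
Variables (R : comNzRingType) (V : lmodType R).

Definition wedge (f g : {scalar V}) (x y : V) : R := f x * g y - f y * g x.

Variables f g : {scalar V}.

Lemma wedge_is_bilinear : bilinear_for *%R *%R (wedge f g).
Proof. by split=> u a x y; rewrite /wedge !linearP /=; ring. Qed.

HB.instance Definition _ :=
  bilinear_isBilinear.Build R V V R *%R *%R (wedge f g) wedge_is_bilinear.

Lemma wedgexx x : wedge f g x x = 0.
Proof. exact: subrr. Qed.

End Wedge.

Definition aff (R : realType) := 'rV[R]_2.

HB.instance Definition _ (R : realType) := GRing.Lmodule.on (aff R).

Section Aff.
Variable R : realType.

Definition aff_e1 : aff R := delta_mx 0 0.
Definition aff_e2 : aff R := delta_mx 0 1.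

Definition aff_dual (i : 'I_2) (x : aff R) : R := x 0 i.

Lemma aff_dual_is_scalar i : scalar (aff_dual i).
Proof. by move=> a x y; rewrite /aff_dual !mxE. Qed.

HB.instance Definition _ i :=
  GRing.isLinear.Build R (aff R) R *%R (aff_dual i) (aff_dual_is_scalar i).

Definition aff_dual1 : {scalar aff R} := aff_dual 0.
Definition aff_dual2 : {scalar aff R} := aff_dual 1.

Lemma aff_dualE :
  [/\ aff_dual1 aff_e1 = 1, aff_dual1 aff_e2 = 0,
      aff_dual2 aff_e1 = 0 & aff_dual2 aff_e2 = 1].
Proof. by split; rewrite /= /aff_dual mxE. Qed.

Lemma aff_decomp x : x = aff_dual1 x *: aff_e1 + aff_dual2 x *: aff_e2.
Proof.
apply/rowP => j; rewrite !mxE /= /aff_dual.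
by case: j => -[|[|//]] lt_j; rewrite !(mulr1, mulr0, addr0, add0r);
  congr (x _ _); apply/val_inj.
Qed.

Definition aff_omega : {biscalar aff R} := wedge aff_dual1 aff_dual2.

Lemma aff_omega_nondegenerate x : (forall y, aff_omega x y = 0) -> x = 0.
Proof.
have [e11 e12 e21 e22] := aff_dualE.
move=> x0; have := x0 aff_e1; have := x0 aff_e2.
rewrite /aff_omega /= /wedge e11 e12 e21 e22 !mulr1 mulr0 mul0r mul1r.
rewrite subr0 sub0r => x1 /eqP; rewrite oppr_eq0 => /eqP x2.
by rewrite (aff_decomp x) x1 x2 !scale0r addr0.
Qed.

Definition aff_bracket (x y : aff R) : aff R :=
  (aff_dual1 x * aff_dual2 y - aff_dual1 y * aff_dual2 x) *: aff_e2.

Lemma aff_bracket_is_bilinear : bilinear_for *:%R *:%R aff_bracket.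
Proof.
by split=> u a x y; rewrite /aff_bracket /= !linearP /= scalerA -scalerDl;
  congr (_ *: _); ring.
Qed.

HB.instance Definition _ :=
  bilinear_isBilinear.Build R (aff R) (aff R) (aff R) *:%R *:%R
    aff_bracket aff_bracket_is_bilinear.

Lemma aff_bracketxx x : aff_bracket x x = 0.
Proof. by rewrite /aff_bracket subrr scale0r. Qed.

Lemma aff_bracket_jacobi x y z :
  aff_bracket x (aff_bracket y z) + aff_bracket y (aff_bracket z x)
    + aff_bracket z (aff_bracket x y) = 0.
Proof.
have [_ e12 _ e22] := aff_dualE.
rewrite /aff_bracket -!scalerDl !(linearZ_LR aff_dual1) !(linearZ_LR aff_dual2).
rewrite e12 e22 /= -[RHS](scale0r aff_e2); congr (_ *: _); ring.
Qed.

HB.instance Definition _ :=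
  Lmodule_isLie.Build R (aff R) aff_bracketxx aff_bracket_jacobi.

Lemma aff_lie12 : lie aff_e1 aff_e2 = aff_e2.
Proof.
have [e11 e12 e21 e22] := aff_dualE.
by rewrite /lie /= /aff_bracket e11 e12 e22 mulr1 mul0r subr0 scale1r.
Qed.

End Aff.

Arguments aff_e1 {R}.
Arguments aff_e2 {R}.

(* Main.v *)
Require Import Defs.
From mathcomp Require Import all_boot all_order all_algebra.
From mathcomp Require Import reals.
From mathcomp Require Import ring lra.

Import GRing.Theory.
Local Open Scope ring_scope.

(** In the basis (e1, e2) the operator D e1 is a 2x2 matrix, and so is D e2.
    Parallelism of e^1 /\ e^2 says that both have trace zero, so that, with
    torsion-freeness, D is described by four reals a, b, c, r:
      D e1 e1 = a e1 + b e2,   D e1 e2 = c e1 - a e2,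
      D e2 e1 = c e1 - (1 + a) e2,   D e2 e2 = r e1 - c e2.
    Flatness reduces to the single matrix identity [D e1, D e2] = D e2, that is
      r b = - c (a + 2),   2 c^2 = r (2 a - 1),   2 b c = - (1 + a) (1 + 2 a).
    The elimination [flat_constants] shows that this forces c = r = 0 and
    (1 + a) (1 + 2 a) = 0, with b free: the root a = -1 is the first family and
    a = -1/2 the second.  Conversely [triangular_connection] checks that these
    values give a flat, torsion-free and parallel connection, by computing both
    coordinates of every identity with [connection_coord]. *)

Section AffConnections.
Variable R : realType.
Implicit Types (x y z : aff R) (D : {bilinear aff R -> aff R -> aff R}).

Lemma aff_eqP x y :
  aff_dual1 R x = aff_dual1 R y -> aff_dual2 R x = aff_dual2 R y -> x = y.
Proof. by move=> eq1 eq2; rewrite (aff_decomp x) (aff_decomp y) eq1 eq2. Qed.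

Lemma aff_coord (a b : R) :
  aff_dual1 R (a *: aff_e1 + b *: aff_e2) = a /\
  aff_dual2 R (a *: aff_e1 + b *: aff_e2) = b.
Proof.
have [e11 e12 e21 e22] := aff_dualE R.
by rewrite !linearD !linearZ e11 e12 e21 e22 /= !mulr0 !mulr1 addr0 add0r.
Qed.

Lemma aff_lie_coord x y :
  aff_dual1 R (lie x y) = 0 /\
  aff_dual2 R (lie x y) =
    aff_dual1 R x * aff_dual2 R y - aff_dual1 R y * aff_dual2 R x.
Proof.
by have := aff_coord 0 (aff_dual1 R x * aff_dual2 R y
  - aff_dual1 R y * aff_dual2 R x); rewrite scale0r add0r.
Qed.

Lemma connection_coord D (f : {scalar aff R}) x y :
  f (D x y) =
    aff_dual1 R x * aff_dual1 R y * f (D aff_e1 aff_e1)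
  + aff_dual1 R x * aff_dual2 R y * f (D aff_e1 aff_e2)
  + aff_dual2 R x * aff_dual1 R y * f (D aff_e2 aff_e1)
  + aff_dual2 R x * aff_dual2 R y * f (D aff_e2 aff_e2).
Proof.
rewrite {1}(aff_decomp x) {1}(aff_decomp y).
rewrite linearDl !linearZl_LR !linearDr !linearZr_LR.
by rewrite !(linearD, linearZ) /=; ring.
Qed.

(** Multiplying the first equation by 2 c and eliminating b c and c^2 with the
    other two leaves r (1 + a) (1 + 2 a) = r (2 a - 1) (a + 2).  The two
    quadratics in a differ by the constant 3, so r = 0; then c^2 = 0 by the
    second equation, and the third one leaves the two roots. *)
Lemma flat_constants (F : realFieldType) (a b c r : F) :
  r * b = - (c * (a + 2)) -> 2 * c ^+ 2 = r * (2 * a - 1) ->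
  2 * b * c = - ((1 + a) * (1 + 2 * a)) ->
  [/\ c = 0, r = 0 & a = - 1 \/ a = - (1 / 2)].
Proof.
move=> eq11 eq12 eq21.
have r0 : r = 0.
  have : 3 * r = 0.
    have -> : 3 * r = r * ((1 + a) * (1 + 2 * a)) - r * (2 * a - 1) * (a + 2).
      by ring.
    rewrite -eq12 -[(1 + a) * _]opprK -eq21.
    have -> : r * - (2 * b * c) = - 2 * c * (r * b) by ring.
    by rewrite eq11; ring.
  lra.
have c0 : c = 0.
  by move: eq12; rewrite r0 mul0r => /eqP; rewrite mulf_eq0 expf_eq0 /=
    Num.Theory.pnatr_eq0 => /eqP.
split=> //.
move: eq21; rewrite c0 mulr0 => /esym/eqP; rewrite oppr_eq0 mulf_eq0.
by case/orP=> /eqP ?; [left | right]; lra.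
Qed.

(** Trace-freeness of D e1 and D e2 is the case (x, e1, e2) of parallelism, the
    case (x, y, y) being trivial. *)
Lemma parallel_trace0 D x : parallel (aff_omega R) D ->
  aff_dual2 R (D x aff_e2) = - aff_dual1 R (D x aff_e1).
Proof.
have [e11 e12 e21 e22] := aff_dualE R.
move=> /(_ x aff_e1 aff_e2); rewrite /aff_omega /= /wedge e11 e12 e21 e22; lra.
Qed.

Lemma symplectic_connection_constants D :
  flat D -> torsion_free D -> parallel (aff_omega R) D ->
  exists a b : R,
    [/\ a = - 1 \/ a = - (1 / 2), D aff_e1 aff_e1 = a *: aff_e1 + b *: aff_e2,
        D aff_e1 aff_e2 = - a *: aff_e2, D aff_e2 aff_e1 = - (1 + a) *: aff_e2
      & D aff_e2 aff_e2 = 0].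
Proof.
have [e11 e12 e21 e22] := aff_dualE R.
move=> flatD torsionD parD.
have tr1 := parallel_trace0 D aff_e1 parD.
have tr2 := parallel_trace0 D aff_e2 parD.
have tor := torsionD aff_e1 aff_e2; rewrite aff_lie12 in tor.
have tor1 := congr1 (aff_dual1 R) tor.
have tor2 := congr1 (aff_dual2 R) tor.
have fl z : D aff_e1 (D aff_e2 z) - D aff_e2 (D aff_e1 z) = D aff_e2 z.
  by rewrite flatD aff_lie12.
have fl11 := congr1 (aff_dual1 R) (fl aff_e1).
have fl12 := congr1 (aff_dual1 R) (fl aff_e2).
have fl21 := congr1 (aff_dual2 R) (fl aff_e1).
rewrite !linearB e12 e22 in tor1 tor2.
rewrite !linearB !(connection_coord D _ _ (D _ _)) e11 e12 e21 e22
  in fl11 fl12 fl21.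
set a := aff_dual1 R (D aff_e1 aff_e1) in tr1 fl11 fl12 fl21 *.
set b := aff_dual2 R (D aff_e1 aff_e1) in fl11 fl12 fl21.
set c := aff_dual1 R (D aff_e1 aff_e2) in tor1 fl11 fl12 fl21.
set r := aff_dual1 R (D aff_e2 aff_e2) in fl11 fl12 fl21.
have E21 : aff_dual1 R (D aff_e2 aff_e1) = c by lra.
have F21 : aff_dual2 R (D aff_e2 aff_e1) = - (1 + a) by lra.
rewrite E21 in tr2 fl11 fl12 fl21.
rewrite F21 tr1 tr2 in fl11 fl12 fl21.
have [||| c0 r0 aE] := @flat_constants R a b c r; [lra.. |].
exists a, b; split=> //.
- exact: aff_decomp.
- by rewrite [LHS]aff_decomp tr1 -/c c0 scale0r add0r.
- by rewrite [LHS]aff_decomp E21 F21 c0 scale0r add0r.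
- by rewrite [LHS]aff_decomp tr2 -/r c0 r0 oppr0 !scale0r addr0.
Qed.

(** Every D x is lower triangular here, and the only obstruction to flatness is
    the e2-coordinate of [D e1, D e2] e1 - D e2 e1, namely
    (1 + a) (1 + 2 a), so that both roots are treated at once. *)
Lemma triangular_connection D (a b : R) :
  (1 + a) * (1 + 2 * a) = 0 ->
  D aff_e1 aff_e1 = a *: aff_e1 + b *: aff_e2 ->
  D aff_e1 aff_e2 = - a *: aff_e2 ->
  D aff_e2 aff_e1 = - (1 + a) *: aff_e2 ->
  D aff_e2 aff_e2 = 0 ->
  [/\ flat D, torsion_free D & parallel (aff_omega R) D].
Proof.
have [_ e12 _ e22] := aff_dualE R.
move=> aE D11 D12 D21 D22.
have [D11_1 D11_2] := aff_coord a b.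
have C1 x y : aff_dual1 R (D x y) = aff_dual1 R x * aff_dual1 R y * a.
  rewrite connection_coord D12 D21 D22 D11 D11_1 !linearZ e12 linear0 /=; ring.
have C2 x y : aff_dual2 R (D x y) = aff_dual1 R x * aff_dual1 R y * b
    - aff_dual1 R x * aff_dual2 R y * a
    - aff_dual2 R x * aff_dual1 R y * (1 + a).
  rewrite connection_coord D12 D21 D22 D11 D11_2 !linearZ e22 linear0 /=; ring.
split.
- move=> x y z; have [l1 l2] := aff_lie_coord x y.
  apply: aff_eqP; rewrite linearB !(C1, C2) l1 ?l2; first by ring.
  set k := (aff_dual1 R x * aff_dual2 R y - aff_dual1 R y * aff_dual2 R x)
    * aff_dual1 R z.
  have k0 : k * ((1 + a) * (1 + 2 * a)) = 0 by rewrite aE mulr0.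
  by rewrite -[RHS]addr0 -[X in _ = _ + X]k0 /k; ring.
- move=> x y; have [l1 l2] := aff_lie_coord x y.
  by apply: aff_eqP; rewrite linearB !(C1, C2) ?l1 ?l2; ring.
- by move=> x y z; rewrite /aff_omega /= /wedge !(C1, C2); ring.
Qed.

End AffConnections.

Theorem theorem4p3 (R : realType) (D : {bilinear aff R -> aff R -> aff R}) :
  [/\ flat D, torsion_free D & parallel (aff_omega R) D] <->
  (exists alpha : R,
     [/\ D aff_e1 aff_e1 = - aff_e1 + alpha *: aff_e2,
         D aff_e1 aff_e2 = aff_e2,
         D aff_e2 aff_e1 = 0
       & D aff_e2 aff_e2 = 0]) \/
  (exists alpha : R,
     [/\ D aff_e1 aff_e1 = - (1 / 2%:R) *: aff_e1 + alpha *: aff_e2,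
         D aff_e1 aff_e2 = (1 / 2%:R) *: aff_e2,
         D aff_e2 aff_e1 = - (1 / 2%:R) *: aff_e2
       & D aff_e2 aff_e2 = 0]).
Proof.
split.
- case=> flatD torD parD.
  have [a [b [aE -> -> -> ->]]] :=
    symplectic_connection_constants R D flatD torD parD.
  case: aE => ->; [left | right]; exists b; split=> //.
  + by rewrite scaleN1r.
  + by rewrite opprK scale1r.
  + by rewrite subrr oppr0 scale0r.
  + by rewrite opprK.
  + by congr (_ *: _); lra.
- case=> -[b [D11 D12 D21 D22]].
  + apply: (triangular_connection R D (- 1) b) => //.
    * by ring.
    * by rewrite scaleN1r.
    * by rewrite opprK scale1r.
    * by rewrite subrr oppr0 scale0r.
  + apply: (triangular_connection R D (- (1 / 2)) b) => //.
    * by field.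
    * by rewrite opprK.
    * by rewrite D21; congr (_ *: _); lra.
Qed.
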